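(* Let $X$ and $Y$ be nonnegative integers and $n\ge1$ an integer. Then $$\det_{0\le i,j\le 2n-1}\left((i-j)\frac{(X+i+j)!}{(Y+i+j)!}\right)=\prod_{i=0}^{2n-1}\frac{(X+i)!}{(Y+i+2n-1)!}\;\prod_{i=0}^{n-1}(2i+1)!^2\,(X+2i+1)\,(Y+4n-2i-2)\,(X-Y-2i)^{2n-2i-2}\,(X-Y-2i-1)^{2n-2i-2}.$$ *)

(* Defs.v *)
From HB Require Import structures.
From mathcomp Require Export all_boot all_order all_algebra.

#[export] Set Implicit Arguments.
#[export] Unset Strict Implicit.
#[export] Unset Printing Implicit Defensive.

(* Main.v *)
Require Import Defs.
From mathcomp Require Import all_boot all_order all_algebra.
From mathcomp Require Import zify ring.
Import Order.TTheory GRing.Theory Num.Theory.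
Local Open Scope ring_scope.

(** The matrix is the Gram matrix of the skew form <x^i, x^j> = (i - j) mu_(i+j),
    where mu is a Jacobi moment sequence.  In the basis of the Jacobi polynomials
    p_j = sum_k (-1)^k C(j,k) (Y+j+k-2)!/(X+k)! x^k the form is tridiagonal:
    <x^i, p_j> is the j-th finite difference of a polynomial in k of degree j - 1
    when i + 2 <= j, and of a polynomial of degree j divided by a linear one when
    j = i + 1.  A skew tridiagonal determinant of even size is the product of the
    squares of every other superdiagonal entry. *)

(** * Finite differences of polynomials and of reciprocals *)

Definition altsum (R : comNzRingType) (j : nat) (f : nat -> R) : R :=
  \sum_(k < j.+1) (-1) ^+ k * 'C(j, k)%:R * f k.

Lemma eq_altsum (R : comNzRingType) j (f g : nat -> R) :
  (forall k, (k <= j)%N -> f k = g k) -> altsum j f = altsum j g.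
Proof. by move=> fg; apply: eq_bigr => k _; rewrite fg // -ltnS. Qed.

Lemma altsumD (R : comNzRingType) j (f g : nat -> R) :
  altsum j (fun k => f k + g k) = altsum j f + altsum j g.
Proof. by rewrite -big_split; apply: eq_bigr => k _; rewrite mulrDr. Qed.

Lemma altsumZ (R : comNzRingType) j c (f : nat -> R) :
  altsum j (fun k => c * f k) = c * altsum j f.
Proof. by rewrite mulr_sumr; apply: eq_bigr => k _; rewrite mulrCA. Qed.

(** Pascal's rule. It identifies [altsum j f] with the j-th iterate of the operator sending f(k) to
    f(k) - f(k+1), evaluated at k = 0. *)
Lemma altsumS (R : comNzRingType) j (f : nat -> R) :
  altsum j.+1 f = altsum j f - altsum j (fun k => f k.+1).
Proof.
rewrite /altsum big_ord_recl /= bin0.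
under eq_bigr => k _ do rewrite /bump /= add1n binS natrD mulrDr mulrDl.
rewrite big_split /= big_ord_recr /= (bin_small (ltnSn j)) mulr0 mul0r addr0.
rewrite [X in _ = X - _]big_ord_recl /= bin0 addrA -sumrN; congr (_ + _).
by apply: eq_bigr => k _; rewrite exprS !mulN1r !mulNr.
Qed.

(** The leading terms cancel. Inductively, the difference for [p * 'X + c%:P] is that of [p] times
    ['X], minus [p \Po ('X + 1)]; both terms have size at most [size p]. *)
Lemma size_poly_diff (R : comNzRingType) (p : {poly R}) :
  (size (p - (p \Po ('X + 1)))%R <= (size p).-1)%N.
Proof.
have comp0 : 0 \Po ('X + 1) = 0 :> {poly R} by rewrite -polyC0 comp_polyC.
elim/poly_ind: p => [|p c IHp]; first by rewrite comp0 subr0 size_poly0.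
rewrite comp_poly_MXaddC.
have -> : p * 'X + c%:P - ((p \Po ('X + 1)) * ('X + 1) + c%:P) =
  (p - (p \Po ('X + 1))) * 'X - (p \Po ('X + 1)) by ring.
have [-> | p0] := eqVneq p 0.
  by rewrite comp0 !subr0 mul0r size_poly0.
have sX : size ('X + 1 : {poly R}) = 2 by rewrite -[1]polyC1 size_XaddC.
have sp : (size (p \Po ('X + 1)) <= size p)%N.
  apply: leq_trans (size_comp_poly_leq _ _) _; rewrite sX /= muln1. by rewrite prednK ?size_poly_gt0.
rewrite size_MXaddC (negPf p0) /=.
apply: leq_trans (size_polyD _ _) _; rewrite size_polyN geq_max sp andbT.
apply: leq_trans (size_polyMleq _ _) _; rewrite size_polyX addn2 /=.
by move: p0 IHp; rewrite -size_poly_gt0; case: (size p) => //= m _; rewrite ltnS.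
Qed.

Lemma altsum_poly (R : comNzRingType) j (p : {poly R}) :
  (size p <= j)%N -> altsum j (fun k => p.[k%:R]) = 0.
Proof.
elim: j p => [|j IHj] p.
  by rewrite leqn0 size_poly_eq0 => /eqP ->; rewrite /altsum big_ord1 horner0 mulr0.
move=> sp; rewrite altsumS -mulN1r -altsumZ -altsumD.
rewrite -[RHS](IHj (p - (p \Po ('X + 1)))).
  apply: eq_altsum => k _.
  by rewrite hornerD hornerN horner_comp !hornerE mulN1r natr1.
by apply: leq_trans (size_poly_diff p) _; case: (size p) sp.
Qed.

(** This is the partial fraction expansion of j! / (a (a+1) ... (a+j)). The recurrence [altsumS]
    subtracts the instance at a + 1 from the one at a. *)
Lemma altsum_inv (R : numFieldType) j (a : R) : 0 < a ->
  altsum j (fun k => (a + k%:R)^-1) = j`!%:R / \prod_(l < j.+1) (a + l%:R).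
Proof.
elim: j a => [|j IHj] a a0.
  by rewrite /altsum !big_ord1 fact0 expr0 bin0 !mul1r addr0.
have pos (m : nat) : a + m%:R != 0 by rewrite gt_eqF // ltr_wpDr.
rewrite altsumS IHj //.
rewrite (@eq_altsum _ _ _ (fun k => (a + 1 + k%:R)^-1)); last first.
  by move=> k _; rewrite -addrA nat1r.
rewrite IHj ?ltr_wpDr //.
(* The factors a+1, ..., a+j are common to all the products involved. *)
have shift : \prod_(l < j) (a + (bump 0 l)%:R) = \prod_(l < j) (a + 1 + l%:R).
  by apply: eq_bigr => l _; rewrite /bump /= add1n -addrA nat1r.
have pos' : \prod_(l < j) (a + 1 + l%:R) != 0.
  by apply/prodf_neq0 => l _; rewrite -addrA nat1r pos.
rewrite (big_ord_recl j) (big_ord_recl j.+1) !big_ord_recr /= shift addr0 factS natrM.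
rewrite /bump /= add1n -!nat1r addrA.
have := pos 0%N; have := pos j.+1; rewrite -nat1r addr0 addrA => p1 p0.
by field; rewrite pos' p0 p1.
Qed.

(** * Skew-symmetric determinants and congruence *)

Lemma det_skew_tridiagonal (R : comNzRingType) n (b : nat -> nat -> R) :
  (forall i j, b j i = - b i j) -> (forall i, b i i = 0) ->
  (forall i j, (i.+1 < j)%N -> b i j = 0) ->
  \det (\matrix_(i < n.*2, j < n.*2) b i j) =
  \prod_(k < n) b k.*2 k.*2.+1 ^+ 2.
Proof.
move=> bC b0 bT; elim: n b bC b0 bT => [|n IHn] b bC b0 bT.
  by rewrite big_ord0 det_mx00.
have b0j j : b 0%N j.+2 = 0 by exact: bT.
(* Only [b 0 1] survives in row 0; in its minor only [b 1 0] survives in column 0. What remains is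
   the same determinant with indices shifted by 2. *)
rewrite doubleS (expand_det_row _ 0) 3!big_ord_recl big1 => [|j _]; last first.
  by rewrite mxE b0j mul0r.
rewrite !mxE b0 mul0r add0r addr0 /= /cofactor.
rewrite (expand_det_col _ 0) big_ord_recl big1 => [|j _]; last first.
  by rewrite !mxE bC b0j oppr0 mul0r.
rewrite !mxE /cofactor addr0 /=.
set M := row' _ _.
have -> : M = \matrix_(i < n.*2, j < n.*2) b i.+2 j.+2.
  by apply/matrixP => i j; rewrite !mxE.
rewrite (IHn (fun i j => b i.+2 j.+2)) // => [|i j ij]; last exact: bT.
rewrite /bump /= bC; ring.
Qed.

(** The congruence Q A Q^T by the lower triangular matrix of the [q j k] is skew and tridiagonal:
    row i combines only the sums attached to indices k <= i, so vanishing for i + 1 < j is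
    inherited, and on the superdiagonal only k = i contributes. *)
Lemma det_skew_triangularize (R : numDomainType) n (a q : nat -> nat -> R) :
  (forall i j, a j i = - a i j) -> (forall j k, (j < k)%N -> q j k = 0) ->
  (forall i j, (i.+1 < j)%N -> \sum_(k < j.+1) q j k * a i k = 0) ->
  (\prod_(j < n.*2) q j j) ^+ 2 * \det (\matrix_(i < n.*2, j < n.*2) a i j) =
  \prod_(i < n) (q i.*2 i.*2 * \sum_(k < i.*2.+2) q i.*2.+1 k * a i.*2 k) ^+ 2.
Proof.
move=> aC qT c0.
pose c i j := \sum_(k < j.+1) q j k * a i k.
pose b i j := \sum_(k < i.+1) q i k * c k j.
have bC i j : b j i = - b i j.
  have bE i' j' :
    b i' j' = \sum_(k < i'.+1) \sum_(l < j'.+1) q i' k * q j' l * a k l.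
    by apply: eq_bigr => k _; rewrite mulr_sumr; apply: eq_bigr => l _; rewrite mulrA.
  rewrite !bE exchange_big -sumrN; apply: eq_bigr => k _ /=.
  by rewrite -sumrN; apply: eq_bigr => l _; rewrite aC mulrN (mulrC (q j l)).
(* Skew symmetry forces a zero diagonal because the characteristic is 0. *)
have b0 i : b i i = 0 by apply/eqP; rewrite -eqNr -bC.
have bT i j : (i.+1 < j)%N -> b i j = 0.
  by move=> ij; apply: big1 => k _; rewrite /c c0 ?mulr0 //; have := ltn_ord k; lia.
have b1 i : b i i.+1 = q i i * c i i.+1.
  by rewrite /b big_ord_recr big1 /= ?add0r // => k _; rewrite /c c0 ?mulr0 ?ltnS.
rewrite -[RHS](eq_bigr _ (fun i _ => congr1 (fun x => x ^+ 2) (b1 _))).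
rewrite -(det_skew_tridiagonal n bC b0 bT).
pose A := \matrix_(i < n.*2, j < n.*2) a i j.
pose Q := \matrix_(i < n.*2, j < n.*2) q i j.
have -> : \matrix_(i < n.*2, j < n.*2) b i j = Q *m A *m Q^T.
  (* Since [q j k] vanishes for k > j, the truncated sums are full matrix products. *)
  have sumT (j : 'I_n.*2) (f : nat -> R) :
    \sum_(k < j.+1) q j k * f k = \sum_(k < n.*2) q j k * f k.
    rewrite (big_ord_widen _ (fun k => q j k * f k) (ltn_ord j)) big_mkcond.
    by apply: eq_bigr => k _; case: ltnP => // /qT ->; rewrite mul0r.
  apply/matrixP => i j; rewrite -mulmxA !mxE /b (sumT i (c^~ j)).
  apply: eq_bigr => k _; rewrite !mxE /c (sumT j (a k)); congr (_ * _).
  by apply: eq_bigr => l _; rewrite !mxE mulrC.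
rewrite !det_mulmx det_tr (det_trig (A := Q)); last first.
  by apply/is_trig_mxP => i j ij; rewrite mxE qT.
have -> : \prod_(i < n.*2) Q i i = \prod_(i < n.*2) q i i.
  by apply: eq_bigr => i _; rewrite mxE.
by rewrite /A; ring.
Qed.

(** * Division by a linear factor, and rising factorials as polynomials *)

Lemma altsum_poly_div (R : numFieldType) j (p : {poly R}) (a : R) :
  0 < a -> (size p <= j.+1)%N ->
  altsum j (fun k => p.[k%:R] / (a + k%:R)) =
  p.[- a] * (j`!%:R / \prod_(l < j.+1) (a + l%:R)).
Proof.
(* Dividing [p] by X + a leaves the remainder [p.[- a]]. The quotient [r] has degree below j, so its
   alternating sum is 0, and the remainder is handled by [altsum_inv]. *)
move=> a0 sp; have /factor_theorem[r pr] : root (p - p.[- a]%:P) (- a).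
  by rewrite /root hornerD hornerN hornerC subrr.
have sr : (size r <= j)%N.
  have [-> | r0] := eqVneq r 0; first by rewrite size_poly0.
  have -> : (size r <= j)%N = ((size r + size ('X - (- a)%:P)%R).-1 <= j.+1)%N.
    by rewrite size_XsubC addn2.
  rewrite -size_Mmonic ?monicXsubC // -pr.
  apply: leq_trans (size_polyD _ _) _; rewrite size_polyN geq_max sp.
  exact: leq_trans (size_polyC_leq1 _) _.
rewrite -altsum_inv // -altsumZ -[RHS]add0r -(altsum_poly sr) -altsumD.
apply: eq_altsum => k _; have -> : p = r * ('X - (- a)%:P) + p.[- a]%:P.
  by rewrite -pr subrK.
rewrite !hornerE /= subrr mulr0 add0r opprK; field.
by rewrite gt_eqF // ltr_wpDr.
Qed.

(** Its value at k is (c+n+k)! / (c+k)!, which turns ratios of factorials into polynomials in k. *)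
Definition rising_poly (R : comNzRingType) (c n : nat) : {poly R} :=
  \prod_(l < n) ('X + (c + l.+1)%:R%:P).

Lemma size_rising_poly (R : comNzRingType) c n :
  size (rising_poly R c n) = n.+1.
Proof.
rewrite /rising_poly; under eq_bigr => l _ do rewrite -[_%:P]opprK -polyCN.
rewrite -(big_mkord xpredT (fun l => 'X - (- (c + l.+1)%:R)%:P)).
by rewrite size_prod_XsubC size_iota subn0.
Qed.

Lemma rising_poly_fact (R : comNzRingType) c n k :
  (rising_poly R c n).[k%:R] * (c + k)`!%:R = (c + n + k)`!%:R.
Proof.
elim: n => [|n IHn]; first by rewrite /rising_poly big_ord0 hornerC mul1r addn0.
rewrite /rising_poly big_ord_recr hornerM mulrAC [X in X * _]IHn !hornerE /=.
by rewrite -natrD -natrM mulnC addnS addSn factS; congr ((_ * _)%:R); lia.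
Qed.

Lemma horner_rising_polyN (R : comNzRingType) (X Y m : nat) :
  (rising_poly R X m).[- (Y + m)%:R] = \prod_(l < m) (X%:R - Y%:R - l%:R).
Proof.
rewrite horner_prod (reindex_inj rev_ord_inj); apply: eq_bigr => l _ /=.
rewrite !hornerE /= subnSK // natrD natrD natrB //; first ring.
exact: ltnW.
Qed.

Lemma prod_fact_ratio (R : comNzRingType) m n :
  (\prod_(l < n) (m.+1%:R + l%:R)) * m`!%:R = (m + n)`!%:R :> R.
Proof.
elim: n => [|n IHn]; first by rewrite big_ord0 mul1r addn0.
by rewrite big_ord_recr mulrAC IHn /= -natrD -natrM mulnC addnS factS addSn.
Qed.

(** * Pairings of monomials with Jacobi polynomials *)

Definition hankel_skew (X Y i j : nat) : rat :=
  (i%:R - j%:R) * ((X + i + j)`!%:R / (Y + i + j)`!%:R).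

(* The truncated subtraction only matters for j <= 1, where any nonzero value
   would do: changing p_1 by a multiple of p_0 does not affect <p_0, p_1>. *)
Definition jacobi_coef (X Y j k : nat) : rat :=
  (-1) ^+ k * 'C(j, k)%:R * ((Y + j + k - 2)`!%:R / (X + k)`!%:R).

Definition jacobi_moment (X Y i j : nat) : rat :=
  \sum_(k < j.+1) jacobi_coef X Y j k * hankel_skew X Y i k.

(** The denominator (X+k)! of the coefficient combines with (X+i+k)! into a polynomial in k of
    degree i. *)
Lemma jacobi_momentE X Y i j :
  jacobi_moment X Y i j = altsum j (fun k =>
    (((i%:R)%:P - 'X) * rising_poly rat X i).[k%:R] *
    ((Y + j + k - 2)`!%:R / (Y + i + k)`!%:R)).
Proof.
apply: eq_bigr => k _; rewrite /jacobi_coef -[LHS]mulrA; congr (_ * _).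
rewrite /hankel_skew -(rising_poly_fact _ X i k) hornerM [(_ - _).[_]]hornerD hornerN hornerC hornerX.
by field; rewrite !pnatr_eq0 -!lt0n !fact_gt0.
Qed.

Lemma size_skew_factor X i :
  size (((i%:R)%:P - 'X) * rising_poly rat X i) = i.+2.
Proof.
have -> : (i%:R)%:P - 'X = - ('X - (i%:R)%:P) :> {poly rat} by rewrite opprB.
rewrite mulNr size_polyN size_monicM ?monicXsubC -?size_poly_gt0 ?size_rising_poly //.
by rewrite size_XsubC.
Qed.

(** Here (Y+j+k-2)! / (Y+i+k)! is a polynomial in k of degree j - i - 2, so the total degree is j -
    1 and the j-th difference vanishes. *)
Lemma jacobi_moment_eq0 X Y i j : (i.+1 < j)%N -> jacobi_moment X Y i j = 0.
Proof.
move=> ij; rewrite jacobi_momentE.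
rewrite (eq_altsum (g := fun k => (((i%:R)%:P - 'X) * rising_poly rat X i *
  rising_poly rat (Y + i) (j - i - 2)).[k%:R])).
  apply: altsum_poly; apply: leq_trans (size_polyMleq _ _) _.
  by rewrite size_skew_factor size_rising_poly; lia.
move=> k _; cbv beta; rewrite [RHS]hornerM; congr (_ * _).
have -> : (Y + j + k - 2 = Y + i + (j - i - 2) + k)%N by lia.
rewrite -rising_poly_fact mulfK //.
by rewrite pnatr_eq0 -lt0n fact_gt0.
Qed.

(** For j = m + 1 the ratio of factorials is 1 / (Y+m+k), so [altsum_poly_div] applies with a = Y +
    m. The leading coefficient is kept as a factor, to be cancelled against the determinant of the
    change of basis. *)
Lemma jacobi_moment_next X Y m :
  jacobi_moment X Y m m.+1 = - (-1) ^+ m * jacobi_coef X Y m.+1 m.+1 *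
   (m.+1`!%:R * (X + m.+1)`!%:R * (Y + m - 1)`!%:R * \prod_(l < m) (X%:R - Y%:R - l%:R)
    / ((Y + m.*2 + 1)`!%:R * (Y + m.*2 - 1)`!%:R)).
Proof.
have f0 k : k`!%:R != 0 :> rat by rewrite pnatr_eq0 -lt0n fact_gt0.
(* For m = 0 the number a = Y + m may be 0 and the subtraction may truncate, so the two-term sum is
   computed directly. *)
case: m => [|m].
  rewrite /jacobi_moment big_ord_recr big_ord1 /hankel_skew /= subrr mul0r mulr0 add0r.
  rewrite big_ord0 !addn0 addn1 (erefl : 1`! = 1%N) addn1 expr0.
  have := f0 Y.+1; have := f0 (Y - 1)%N.
  move: (jacobi_coef _ _ _ _) (Y.+1`!%:R : rat) ((Y - 1)`!%:R : rat) => q v u u0 v0.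
  by field; rewrite u0 v0.
set M := m.+1; rewrite jacobi_momentE.
have a0 : 0 < (Y + M)%:R :> rat by rewrite ltr0n /M; lia.
rewrite (eq_altsum (g := fun k => (((M%:R)%:P - 'X) * rising_poly rat X M).[k%:R] /
  ((Y + M)%:R + k%:R))); last first.
  move=> k _; congr (_ * _); rewrite -natrD.
  have -> : (Y + M.+1 + k - 2 = (Y + M + k).-1)%N by lia.
  have : (0 < Y + M + k)%N by rewrite /M; lia.
  case: (Y + M + k)%N => // h _; by rewrite /= factS natrM invfM mulrCA divff ?mulr1.
rewrite altsum_poly_div ?size_skew_factor // hornerM horner_rising_polyN.
rewrite [(_ - _).[_]]hornerD hornerN hornerC hornerX opprK.
have := prod_fact_ratio rat (Y + m) M.+2.
have -> : \prod_(l < M.+2) ((Y + m).+1%:R + l%:R) =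
    \prod_(l < M.+2) ((Y + M)%:R + l%:R) :> rat.
  by apply: eq_bigr => l _; rewrite -addnS.
have P0 : \prod_(l < M.+2) ((Y + M)%:R + l%:R) != 0 :> rat.
  by apply/prodf_neq0 => l _; rewrite gt_eqF // ltr_wpDr.
have -> : (Y + m + M.+2 = Y + M.*2 + 1)%N by rewrite /M; lia.
move=> PE; rewrite -PE -natrD /jacobi_coef binn mulr1.
have -> : (M + (Y + M) = (Y + M.*2 - 1).+1)%N by rewrite /M; lia.
have -> : (Y + M.+1 + M.+1 - 2 = (Y + M.*2 - 1).+1)%N by rewrite /M; lia.
have -> : (Y + M - 1 = Y + m)%N by rewrite /M; lia.
rewrite (factS (Y + M.*2 - 1)) natrM exprS.
have s2 : (-1) ^+ M * (-1) ^+ M = 1 :> rat by rewrite -expr2 sqrr_sign.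
(* The prefactor and the sign of the leading coefficient multiply to 1. *)
have sK z : - (-1) ^+ M * (-1 * (-1) ^+ M * z) = z :> rat.
  by rewrite mulrA mulN1r mulrNN s2 mul1r.
rewrite sK.
have := f0 (X + M.+1)%N; have := f0 (Y + m)%N; have := f0 (Y + M.*2 - 1)%N.
move: (\prod_(l < M.+2) _) ((Y + M.*2 - 1)`!%:R : rat) ((Y + m)`!%:R : rat) ((X + M.+1)`!%:R : rat) P0.
by move=> P u v w P0 u0 v0 w0; field; rewrite P0 u0 v0 w0.
Qed.

(** * Rearranging products of factorials *)

Lemma prod_fact_pair (R : comNzRingType) (X n : nat) :
  \prod_(i < n.*2) (X + i)`!%:R * \prod_(i < n) (X + i.*2.+1)%:R =
  \prod_(i < n) (X + i.*2.+1)`!%:R ^+ 2 :> R.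
Proof.
elim: n => [|n IHn]; first by rewrite !big_ord0 mulr1.
by rewrite doubleS !big_ord_recr /= -IHn addnS factS !natrM; ring.
Qed.

(** The i-th pair of factors occurs in the falling factorials of length 2k with i < k < n, hence n -
    i - 1 times, and each occurrence is squared. *)
Lemma prod_falling_sqr (R : comNzRingType) (d : R) n :
  \prod_(i < n) ((d - i.*2%:R) * (d - i.*2.+1%:R)) ^+ (n - i.+1).*2 =
  \prod_(i < n) (\prod_(l < i.*2) (d - l%:R)) ^+ 2.
Proof.
elim: n => [|n IHn]; first by rewrite !big_ord0.
rewrite !big_ord_recr /= -IHn subnn expr0 mulr1.
have -> : \prod_(l < n.*2) (d - l%:R) =
    \prod_(i < n) ((d - i.*2%:R) * (d - i.*2.+1%:R)).
  elim: n {IHn} => [|n IHn]; first by rewrite !big_ord0.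
  by rewrite doubleS !big_ord_recr /= IHn mulrA.
rewrite -prodrXl -big_split; apply: eq_bigr => i _ /=.
rewrite -exprD; congr (_ ^+ _); have := ltn_ord i; lia.
Qed.

(* For Y = 0 and k = 0 the truncated (Y - 1)`! is 0`! on both sides of the
   quotient, and cancels. *)
Lemma prod_fact_denominator (R : numFieldType) (Y n : nat) :
  \prod_(i < n.+1) (Y + n.+1.*2 + i.*2)%:R /
    \prod_(i < n.+1.*2) (Y + n.*2.+1 + i)`!%:R =
  \prod_(k < n.+1) ((Y + k.*2 - 1)`!%:R /
    ((Y + k.*2.*2 + 1)`!%:R * (Y + k.*2.*2 - 1)`!%:R)) ^+ 2 :> R.
Proof.
have f0 m : m`!%:R != 0 :> R by rewrite pnatr_eq0 -lt0n fact_gt0.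
elim: n => [|n IHn].
  rewrite !big_ord_recl !big_ord0 /= /bump /= !addn0 !addn1 !addn2 (factS Y.+1) natrM.
  have := f0 (Y - 1)%N; have := f0 Y.+1; have: (Y.+2)%:R != 0 :> R by rewrite pnatr_eq0.
  move: ((Y - 1)`!%:R : R) (Y.+1`!%:R : R) (Y.+2%:R : R) => u v w w0 v0 u0.
  by field; rewrite u0 v0 w0.
rewrite [RHS]big_ord_recr /= -IHn.
(* As n grows by 1, the window of linear factors loses its first term and gains two at the end. *)
have stepN : (Y + n.+1.*2)%:R * \prod_(i < n.+2) (Y + n.+2.*2 + i.*2)%:R =
   \prod_(i < n.+1) (Y + n.+1.*2 + i.*2)%:R * (Y + n.+1.*2.*2)%:R * (Y + n.+1.*2.*2.+2)%:R :> R.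
  rewrite -[LHS](_ : \prod_(i < n.+3) (Y + n.+1.*2 + i.*2)%:R = _).
    by rewrite 2!big_ord_recr /=; congr (_ * _%:R * _%:R); lia.
  rewrite big_ord_recl /= addn0; congr (_ * _); apply: eq_bigr => i _.
  by rewrite /bump /=; congr (_%:R); lia.
(* Likewise the window of factorials loses two terms and gains four. *)
have stepD : (Y + n.*2.+1)`!%:R * (Y + n.*2.+2)`!%:R *
   \prod_(i < n.+2.*2) (Y + n.+1.*2.+1 + i)`!%:R =
   \prod_(i < n.+1.*2) (Y + n.*2.+1 + i)`!%:R *
   (Y + n.*2.*2 + 3)`!%:R * (Y + n.*2.*2 + 4)`!%:R *
   (Y + n.*2.*2 + 5)`!%:R * (Y + n.*2.*2 + 6)`!%:R :> R.
  rewrite -[LHS](_ : \prod_(i < n.+2.*2.+2) (Y + n.*2.+1 + i)`!%:R = _).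
    rewrite doubleS 4!big_ord_recr /=.
    by congr (_ * _`!%:R * _`!%:R * _`!%:R * _`!%:R); lia.
  rewrite [LHS]big_ord_recl [X in _ * X = _]big_ord_recl /= mulrA /bump /= addn0 addn1 addnS.
  congr (_ * _); first by rewrite !addnS.
  apply: eq_bigr => i _.
  by congr (_`!%:R); rewrite /bump /=; lia.
have y0 : (Y + n.+1.*2)%:R != 0 :> R by rewrite pnatr_eq0 addn_eq0 andbF.
have z0 : (Y + n.*2.+1)`!%:R * (Y + n.*2.+2)`!%:R != 0 :> R by rewrite mulf_neq0.
rewrite (canRL (mulKf y0) stepN) (canRL (mulKf z0) stepD).
have D0 : \prod_(i < n.+1.*2) (Y + n.*2.+1 + i)`!%:R != 0 :> R.
  by apply/prodf_neq0 => i _.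
move: (\prod_(i < n.+1) _) (\prod_(i < n.+1.*2) _) D0 y0 {z0 stepN stepD IHn} => N D D0.
rewrite !doubleS !addnS !addn0 !subn1 !succnK.
set c := (Y + n.*2)%N; set e := (Y + n.*2.*2)%N => c0.
have fS m : (m.+1)`!%:R = m.+1%:R * m`!%:R :> R by rewrite factS natrM.
rewrite (fS c.+1) (fS e.+3) (fS e.+4.+1).
have := f0 c.+1; have := f0 e.+3; have := f0 e.+4.+1.
have : e.+4%:R != 0 :> R by rewrite pnatr_eq0.
have : e.+4.+2%:R != 0 :> R by rewrite pnatr_eq0.
move: (c.+2%:R : R) (c.+1`!%:R : R) (e.+3`!%:R : R) (e.+4.+1`!%:R : R) (e.+4%:R : R) (e.+4.+2%:R : R) c0.
move=> x1 x2 x3 x4 x5 x6 h1 h6 h5 h4 h3 h2.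
by field; rewrite D0 ?h1 ?h2 ?h3 ?h4 ?h5 ?h6.
Qed.

(** * Evaluation of the determinant and passage to the stated product *)

Lemma det_hankel_skew X Y n :
  \det (\matrix_(i < n.*2, j < n.*2) hankel_skew X Y i j) =
  \prod_(k < n) (k.*2.+1`!%:R * (X + k.*2.+1)`!%:R * (Y + k.*2 - 1)`!%:R *
      \prod_(l < k.*2) (X%:R - Y%:R - l%:R) /
    ((Y + k.*2.*2 + 1)`!%:R * (Y + k.*2.*2 - 1)`!%:R)) ^+ 2.
Proof.
have q0 j : jacobi_coef X Y j j != 0.
  by rewrite /jacobi_coef binn mulr1 mulf_neq0 ?signr_eq0 // mulf_neq0 ?invr_eq0 // pnatr_eq0 -lt0n fact_gt0.
have aC i j : hankel_skew X Y j i = - hankel_skew X Y i j.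
  by rewrite /hankel_skew -mulNr opprB -!addnA (addnC j).
have qT j k : (j < k)%N -> jacobi_coef X Y j k = 0.
  by move=> jk; rewrite /jacobi_coef bin_small // mulr0 mul0r.
have Q0 : (\prod_(j < n.*2) jacobi_coef X Y j j) ^+ 2 != 0.
  by rewrite expf_neq0 //; apply/prodf_neq0 => j _.
(* The congruence gives the determinant only up to the square of that of the base change, which is
   nonzero. *)
apply: (mulfI Q0).
rewrite (det_skew_triangularize n aC qT (@jacobi_moment_eq0 X Y)).
(* Pairing the diagonal entries matches them with the two leading coefficients present in each
   superdiagonal entry. *)
have -> : \prod_(j < n.*2) jacobi_coef X Y j j =
    \prod_(k < n) (jacobi_coef X Y k.*2 k.*2 * jacobi_coef X Y k.*2.+1 k.*2.+1).
  elim: n {Q0} => [|n IHn]; first by rewrite !big_ord0.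
  by rewrite doubleS !big_ord_recr /= IHn mulrA.
rewrite -prodrXl -big_split; apply: eq_bigr => k _.
rewrite -[\sum_(_ < _) _]/(jacobi_moment X Y k.*2 k.*2.+1) jacobi_moment_next.
rewrite -[RHS]exprMn.
have -> : (-1) ^+ k.*2 = 1 :> rat by rewrite -signr_odd odd_double.
by rewrite !mulNr mul1r mulrN sqrrN !mulrA.
Qed.

Theorem theorem6 (X Y n : nat) (hn : (1 <= n)%N) :
  \det (\matrix_(i < (2 * n)%N, j < (2 * n)%N)
          ((i%:R - j%:R) * ((X + i + j)`!%N%:R / (Y + i + j)`!%N%:R)) : 'M[rat]_(2 * n)%N) =
  (\prod_(0 <= i < (2 * n)%N)
      ((X + i)`!%N%:R / (Y + i + (2 * n - 1))`!%N%:R)) *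
  \prod_(0 <= i < n)
      ((2 * i + 1)`!%N%:R ^+ 2 *
       (X + 2 * i + 1)%N%:R *
       (Y%:R + 4 * n%:R - 2 * i%:R - 2) *
       (X%:R - Y%:R - 2 * i%:R) ^+ (2 * n - 2 * i - 2)%N *
       (X%:R - Y%:R - 2 * i%:R - 1) ^+ (2 * n - 2 * i - 2)%N).
Proof.
rewrite mul2n (det_hankel_skew X Y n) !big_mkord.
(* Writing n + 1 for n turns the truncated 2n - 1 into [n.*2.+1]. *)
case: n hn => // n _.
have -> : \prod_(k < n.+1) (k.*2.+1`!%:R * (X + k.*2.+1)`!%:R * (Y + k.*2 - 1)`!%:R *
      \prod_(l < k.*2) (X%:R - Y%:R - l%:R) /
    ((Y + k.*2.*2 + 1)`!%:R * (Y + k.*2.*2 - 1)`!%:R)) ^+ 2 =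
  (\prod_(k < n.+1) k.*2.+1`!%:R ^+ 2) *
  (\prod_(k < n.+1) (X + k.*2.+1)`!%:R ^+ 2) *
  (\prod_(k < n.+1) ((Y + k.*2 - 1)`!%:R /
    ((Y + k.*2.*2 + 1)`!%:R * (Y + k.*2.*2 - 1)`!%:R)) ^+ 2) *
  (\prod_(k < n.+1) (\prod_(l < k.*2) (X%:R - Y%:R - l%:R)) ^+ 2) :> rat.
  rewrite -!big_split; apply: eq_bigr => k _ /=; rewrite -!exprMn; congr (_ ^+ 2).
  by rewrite !mulrA; ring.
rewrite -prod_fact_pair -prod_fact_denominator -prod_falling_sqr.
rewrite -prodfV.
have -> : \prod_(i < n.+1.*2) ((X + i)`!%:R / (Y + i + (n.+1.*2 - 1))`!%:R) =
    \prod_(i < n.+1.*2) (X + i)`!%:R * \prod_(i < n.+1.*2) (Y + n.*2.+1 + i)`!%:R^-1 :> rat.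
  rewrite -big_split; apply: eq_bigr => i _ /=.
  by congr (_ / _`!%:R); lia.
(* The same factors in the opposite order, whence the reindexing i -> n - i. *)
have -> : \prod_(i < n.+1) (Y + n.+1.*2 + i.*2)%:R =
   \prod_(i < n.+1) (Y%:R + 4 * n.+1%:R - 2 * i%:R - 2) :> rat.
  rewrite (reindex_inj rev_ord_inj); apply: eq_bigr => i _ /=.
  have ltin := ltn_ord i.
  have -> : (Y + n.+1.*2 + (n.+1 - i.+1).*2 = Y + 4 * n.+1 - (2 * i + 2))%N by lia.
  rewrite natrB; last by lia.
  by rewrite (natrD _ Y) (natrD _ (2 * i)) (natrM _ 4) (natrM _ 2) opprD addrA.
rewrite [X in _ = _ * X](eq_bigr (fun i : 'I_n.+1 => i.*2.+1`!%:R ^+ 2 * (X + i.*2.+1)%:R *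
    (Y%:R + 4 * n.+1%:R - 2 * i%:R - 2) *
    ((X%:R - Y%:R - i.*2%:R) * (X%:R - Y%:R - i.*2.+1%:R)) ^+ (n.+1 - i.+1).*2)); last first.
  move=> i _; rewrite -[LHS]mulrA -[X in _ * X = _]exprMn mul2n -addnA !addn1 -(natrM _ 2 i) mul2n.
  have -> : (n.+1.*2 - i.*2 - 2 = (n.+1 - i.+1).*2)%N by lia.
  by congr (_ * (_ * _) ^+ _); rewrite -natr1 opprD addrA.
rewrite !big_split /=.
ring.
Qed.
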